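(* Let $p$ be a prime, $n\ge 1$ an integer, and let $\Omega$ be a tile of the elementary $p$-group $\mathbb{Z}_p^n$. (1) Case $p\ge 3$: if $\mathbb{Z}_p^n$ has the PT property, then $(\Omega,T)$ is a tiling pair for some subgroup $T$ of $\mathbb{Z}_p^n$. (2) Case $p=2$: if $\mathbb{Z}_2^n$ and $\mathbb{Z}_2^{n-1}$ have the PT property, then $(\Omega,T)$ is a tiling pair for some subgroup $T$ of $\mathbb{Z}_2^n$.
   Context: For a finite abelian group $G$ (written additively), a pair $(\Omega,T)$ of subsets of $G$ is a tiling pair if every $g\in G$ can be written uniquely as $g=\omega+t$ with $\omega\in\Omega$, $t\in T$; then $\Omega$ is called a tile. A nonempty subset $A\subset G$ is periodic if there is a nonzero $g\in G$ with $A+g=A$. $G$ has the periodic tiling property (PT property) if for every tiling pair $(\Omega,T)$ of $G$, either $\Omega$ is periodic, or there is a periodic set $T'\subset G$ such that $(\Omega,T')$ is also a tiling pair. Convention: the trivial group is regarded as having the PT property. *)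

(* Defs.v *)
From mathcomp Require Import all_boot all_order all_fingroup all_algebra.

Set Implicit Arguments.
Unset Strict Implicit.
Unset Printing Implicit Defensive.

Import GRing.Theory.
Local Open Scope ring_scope.

Definition tiling_pair (G : finZmodType) (Omega T : {set G}) : Prop :=
  forall g : G, exists! wt : G * G,
    [/\ wt.1 \in Omega, wt.2 \in T & g = wt.1 + wt.2].

Definition tile (G : finZmodType) (Omega : {set G}) : Prop :=
  exists T : {set G}, tiling_pair Omega T.

Definition periodic (G : finZmodType) (A : {set G}) : Prop :=
  A != set0 /\ exists2 g : G, g != 0 & [set a + g | a in A] = A.

(* The first disjunct is the convention for the trivial group, in which no set
   is periodic and the second disjunct therefore fails. *)
Definition PT_property (G : finZmodType) : Prop :=
  #|G| = 1%N \/
  forall Omega T : {set G}, tiling_pair Omega T ->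
    periodic Omega \/
    exists2 T' : {set G}, periodic T' & tiling_pair Omega T'.

(* Main.v *)
Require Import Defs.
From mathcomp Require Import all_boot all_order all_fingroup all_algebra.
From mathcomp Require Import zify.

(** The PT property descends from H x K to H when #|K| >= 3. Given a tiling
    pair (Omega, T) of H and a nonzero a in H, shift Omega by a in the fibre
    over 0 of H x K and by 0 in all other fibres. This is a tile, and a period
    of it yields a period of Omega. If T' is any complement of it, the number
    P y of representations of y as an element of Omega plus the H-component of
    an element of T' satisfies P (y - a) + (#|K| - 1) P y = #|K|, which forces
    P = 1: the projection of T' to H is a complement of Omega, and it inherits
    periods of T'. With K of order p, or of order 4 when p = 2, all the groups
    Z_p^m with m <= n have the PT property.

    Now argue by induction on n. If g is a period of Omega or of a complement
    of Omega, then the image of Omega in the quotient by <g> is a tile there,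
    and a subgroup complementing it is lifted through a section in the first
    case and pulled back in the second. *)

Set Implicit Arguments.
Unset Strict Implicit.
Unset Printing Implicit Defensive.

Import GRing.Theory.
Local Open Scope ring_scope.

(** * Tilings as counting identities, and periods *)

Lemma tiling_pairP (G : finZmodType) (Omega T : {set G}) :
  tiling_pair Omega T <->
  (forall g : G, \sum_(t in T) ((g - t)%R \in Omega) = 1)%N.
Proof.
split=> [tOT g | sOT g].
  have [[w t] [/= [wO tT ->] uniq_wt]] := tOT g.
  rewrite (bigD1 t) //= addrK wO big1 ?addn0 // => u /andP[uT ut].
  case: (boolP (_ \in _)) => // uO.
  have [] : (w, t) = (w + t - u, u) by apply: uniq_wt; rewrite /= subrK.
  by move=> _ tu; rewrite tu eqxx in ut.
have [t /andP[tT tO]] : exists t, (t \in T) && (g - t \in Omega).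
  case: (pickP (fun t => (t \in T) && (g - t \in Omega))) => [t tP | nO].
    by exists t.
  by have := sOT g; rewrite big1 // => t tT; have := nO t; rewrite tT /= => ->.
exists (g - t, t); split; first by rewrite /= subrK.
move=> [w u] /= [wO uT eg].
have [-> | tu] := eqVneq t u; first by rewrite eg addrK.
have := sOT g; rewrite (bigD1 t) //= tO (bigD1 u) /=; last by rewrite uT eq_sym.
by rewrite {1}eg addrK wO.
Qed.

Lemma tiling_pairC (G : finZmodType) (A B : {set G}) :
  tiling_pair A B -> tiling_pair B A.
Proof.
move=> tAB g; have [[w t] [/= [wA tB eg] uniq_wt]] := tAB g.
exists (t, w); split; first by rewrite /= addrC.
move=> [t' w'] /= [tB' wA' eg']; rewrite addrC in eg'.
by have [-> ->] : (w, t) = (w', t') by apply: uniq_wt.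
Qed.

(** Two elements of [T] with the same image would be counted twice at [y + f t] for [y] in [Omega];
    once [f] is injective on [T], the sum reindexes over [f @: T]. *)
Lemma projection_tiling (G H : finZmodType) (f : {additive G -> H})
    (Omega : {set H}) (T : {set G}) :
  (forall y : H, \sum_(t in T) ((y - f t)%R \in Omega) = 1)%N ->
  {in T &, injective f} /\ tiling_pair Omega (f @: T).
Proof.
move=> sOT; have f_inj : {in T &, injective f}.
  move=> t u tT uT ftu; apply/eqP/negPn/negP => tu.
  have [y yO] : exists y, y \in Omega.
    have [eO | [y yO]] := set_0Vmem Omega; last by exists y.
    by have := sOT 0; rewrite eO big1 // => v _; rewrite inE.
  have := sOT (y + f t); rewrite (bigD1 t) //= (bigD1 u) /= ?uT 1?eq_sym //.
  by rewrite ftu addrK yO.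
by split=> //; apply/tiling_pairP => y; rewrite big_imset.
Qed.

Lemma period_mem (G : finZmodType) (A : {set G}) (g x : G) :
  [set a + g | a in A] = A -> (x + g \in A) = (x \in A).
Proof. by move=> {1}<-; rewrite (mem_imset _ _ (addIr g)). Qed.

Lemma period_mulrn_mem (G : finZmodType) (A : {set G}) (g x : G) k :
  [set a + g | a in A] = A -> (x + g *+ k \in A) = (x \in A).
Proof.
move=> pA; elim: k => [|k IHk]; first by rewrite mulr0n addr0.
by rewrite mulrSr addrA period_mem.
Qed.

Lemma periodic_of_mem (G : finZmodType) (A : {set G}) (g : G) :
  A != set0 -> g != 0 -> (forall x, (x + g \in A) = (x \in A)) -> periodic A.
Proof.
move=> A0 g0 pA; split=> //; exists g => //.
apply/eqP; rewrite eqEcard card_imset ?leqnn ?andbT; last exact: addIr.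
by apply/subsetP => _ /imsetP[x xA ->]; rewrite pA.
Qed.

(** * Descent of the PT property from a product to a factor *)

Section PTDescent.
Variables (R : finNzRingType) (m d : nat).
Implicit Types (a : 'rV[R]_m) (x : 'rV[R]_(m + d)).

(** H is ['rV[R]_m], K is ['rV[R]_d], and H x K is encoded as row vectors with left block in H and
    right block in K. *)
Definition fibre_shift a (k : 'rV[R]_d) : 'rV[R]_m := if k == 0 then a else 0.

Definition shifted_fibres a (Omega : {set 'rV[R]_m}) : {set 'rV[R]_(m + d)} :=
  [set x | lsubmx x - fibre_shift a (rsubmx x) \in Omega].

Lemma mem_shifted_fibres a Omega y k :
  (row_mx y k \in shifted_fibres a Omega) = (y - fibre_shift a k \in Omega).
Proof. by rewrite inE row_mxKl row_mxKr. Qed.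

Lemma shifted_fibres_tiling a Omega T : tiling_pair Omega T ->
  tiling_pair (shifted_fibres a Omega) [set row_mx t 0 | t in T].
Proof.
move=> /tiling_pairP sOT; apply/tiling_pairP => x.
rewrite big_imset /=; last by move=> t u _ _ /eq_row_mx[].
rewrite -[RHS](sOT (lsubmx x - fibre_shift a (rsubmx x))).
apply: eq_bigr => t _; congr (nat_of_bool _).
by rewrite inE !linearB /= row_mxKl row_mxKr subr0 addrAC.
Qed.

Hypothesis card_ge3 : (3 <= #|'rV[R]_d|)%N.

Lemma exists_neq2 (c c' : 'rV[R]_d) : exists k, (k != c) && (k != c').
Proof.
case: (pickP (fun k => (k != c) && (k != c'))) => [k kP | cK]; first by exists k.
suff /subset_leq_card : [set: 'rV[R]_d] \subset [set c; c'].
  by rewrite cardsT cards2 => /(leq_trans card_ge3); case: (c != c').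
apply/subsetP => k _; have := cK k.
by rewrite !inE; case: eqP => //= _ /negbFE.
Qed.

(** A period [(h, c)] carries some unshifted fibre to an unshifted one, so translation by [h]
    preserves [Omega]. If [c] is zero, [h] is nonzero; otherwise the fibre over 0 goes to an
    unshifted fibre, which makes [a] a period. *)
Lemma shifted_fibres_periodic a Omega : a != 0 ->
  periodic (shifted_fibres a Omega) -> periodic Omega.
Proof.
move=> a0 [/set0Pn[z zO] [g g0 /period_mem pO]].
have O0 : Omega != set0.
  by move: zO; rewrite inE => zO; apply/set0Pn; eexists; exact: zO.
set h := lsubmx g; set c := rsubmx g.
have pOE y k : (y + h - fibre_shift a (k + c) \in Omega)
    = (y - fibre_shift a k \in Omega).
  by rewrite -!mem_shifted_fibres -add_row_mx hsubmxK pO.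
have ph y : (y + h \in Omega) = (y \in Omega).
  have [k /andP[k0 kc]] := exists_neq2 0 (- c).
  have := pOE y k.
  by rewrite /fibre_shift addr_eq0 (negPf k0) (negPf kc) !subr0.
have [c0 | c0] := eqVneq c 0.
  apply: (periodic_of_mem O0 _ ph); apply: contra g0 => /eqP h0.
  by rewrite -[g]hsubmxK -/h -/c h0 c0 row_mx0.
apply: (periodic_of_mem O0 a0) => y.
have := pOE (y + a) 0; rewrite /fibre_shift eqxx add0r (negPf c0).
by rewrite subr0 ph addrK.
Qed.

Lemma shifted_fibres_complement a Omega T' :
  tiling_pair (shifted_fibres a Omega) T' ->
  forall y, (\sum_(t in T') ((y - lsubmx t)%R \in Omega) = 1)%N.
Proof.
move=> /tiling_pairP sOT.
pose P y := (\sum_(t in T') ((y - lsubmx t)%R \in Omega))%N.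
pose q := #|'rV[R]_d|; have q_ge3 : (3 <= q)%N := card_ge3.
have PE y : (P (y - a)%R + q.-1 * P y = q)%N.
  (* Sum the tiling identity at [(y, k)] over all [k]: each [t] meets the shifted fibre for the
     single value [k = rsubmx t], and unshifted fibres for the other [q - 1] values. *)
  transitivity (\sum_(k : 'rV[R]_d) 1)%N; last by rewrite sum1_card.
  under [RHS]eq_bigr => k _ do rewrite -(sOT (row_mx y k)).
  rewrite exchange_big /P big_distrr -big_split /=; apply: eq_bigr => t _.
  rewrite (bigD1 (rsubmx t)) //= inE !linearB /= row_mxKl row_mxKr.
  rewrite /fibre_shift subrr eqxx addrAC; congr addn.
  rewrite (eq_bigr (fun=> nat_of_bool (y - lsubmx t \in Omega))).
    by rewrite sum_nat_const cardC1.
  move=> k kt; rewrite inE !linearB /= row_mxKl row_mxKr /fibre_shift subr_eq0.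
  by rewrite (negPf kt) subr0.
(* [P y >= 2] would give [2 (q - 1) <= q], against [q >= 3]. Below, [P y = 0] would give
   [P (y - a) = q], which exceeds 1. *)
have P_le1 y : (P y <= 1)%N by have := PE y; nia.
move=> y; rewrite -/(P y).
move: (PE y) (P_le1 y) (P_le1 (y - a)%R).
by case: (P y) => [|[|k]] //; rewrite muln0 addn0 => ->; lia.
Qed.

Lemma PT_descent : PT_property 'rV[R]_(m + d) -> PT_property 'rV[R]_m.
Proof.
move=> PTG; have [H1 | [a a0]] : #|'rV[R]_m| = 1%N \/ exists a : 'rV[R]_m, a != 0.
- case: (pickP (fun a : 'rV[R]_m => a != 0)) => [a a0 | all0].
    by right; exists a.
  left; apply/eqP/fintype1P; exists 0 => a.
  by have /negbFE/eqP := all0 a.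
- by left.
right=> Omega T tOT; case: PTG => [G1 | PTG].
  have /fintype_le1P G_eq : (#|'rV[R]_(m + d)| <= 1)%N by rewrite G1.
  have /eq_row_mx[aE _] : row_mx a 0 = row_mx 0 0 :> 'rV[R]_(m + d).
    exact: G_eq.
  by rewrite aE eqxx in a0.
have [| [T' [T'0 [g g0 pT]] tOT']] := PTG _ _ (shifted_fibres_tiling a tOT).
  by move=> pO; left; exact: shifted_fibres_periodic pO.
have [l_inj tO] := projection_tiling (shifted_fibres_complement tOT').
right; exists (lsubmx @: T') => //.
split; first by rewrite imset_eq0.
exists (lsubmx g).
  (* If [lsubmx g] vanished, [t] and [t + g] would be elements of [T'] with the same projection. *)
  apply: contra g0 => /eqP lg0; have [t tT] := set0Pn _ T'0.
  apply/eqP/(addrI t); rewrite addr0; apply: l_inj; rewrite ?period_mem //.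
  by rewrite raddfD /= lg0 addr0.
rewrite -{2}pT -!imset_comp; apply: eq_imset => t /=.
by rewrite linearD.
Qed.

End PTDescent.

(** * Passage to a split quotient by a cyclic subgroup *)

Section CyclicQuotient.
Variables (G H : finZmodType) (f : {additive G -> H}) (s : {additive H -> G}).
Variable g : G.
Hypothesis sK : cancel s f.
Hypothesis ker_f : forall x, f x = 0 -> exists k, x = g *+ k.

(** The kernel of [f] consists of multiples of [g], so a set with period [g] is the full preimage of
    its image. *)
Lemma mem_image_periodic (A : {set G}) x :
  [set a + g | a in A] = A -> (f x \in f @: A) = (x \in A).
Proof.
move=> pA; apply/idP/idP => [/imsetP[a aA fxa] | xA]; last exact: imset_f.
have [k xaE] : exists k, x - a = g *+ k by apply: ker_f; rewrite raddfB fxa subrr.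
by rewrite -(subrK a x) xaE addrC period_mulrn_mem.
Qed.

Lemma quotient_tiling (A B : {set G}) : [set a + g | a in A] = A ->
  tiling_pair A B -> {in B &, injective f} /\ tiling_pair (f @: A) (f @: B).
Proof.
move=> pA /tiling_pairP sAB; apply: projection_tiling => y.
rewrite -[RHS](sAB (s y)); apply: eq_bigr => t _.
by rewrite -{1}[y]sK -raddfB mem_image_periodic.
Qed.

Hypothesis tile_H : forall Omega : {set H}, tile Omega ->
  exists2 S : {set H}, zmod_closed S & tiling_pair Omega S.

(** As [Omega] is the full preimage of its image, any lift of a complement of that image, one
    representative per element, complements [Omega]; lifting by the additive [s] keeps it a
    subgroup. *)
Lemma periodic_tile_subgroup_complement (Omega T : {set G}) :
  [set w + g | w in Omega] = Omega -> tiling_pair Omega T ->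
  exists2 S : {set G}, zmod_closed S & tiling_pair Omega S.
Proof.
move=> pO tOT; have [_ tfO] := quotient_tiling pO tOT.
have [|S [S0 SB] /tiling_pairP sOS] := tile_H (Omega := f @: Omega).
  by exists (f @: T).
exists (s @: S).
  split=> [|_ _ /imsetP[u uS ->] /imsetP[v vS ->]].
    by rewrite -(raddf0 s) imset_f.
  by rewrite -raddfB imset_f // SB.
apply/tiling_pairP => x; rewrite big_imset /=; last by move=> u v _ _ /(can_inj sK).
rewrite -[RHS](sOS (f x)); apply: eq_bigr => u _.
by rewrite -{2}[u]sK -raddfB mem_image_periodic.
Qed.

(** Periodicity of [T] makes [f] injective on [Omega], so counting over [Omega] equals counting over
    its image, and the preimage of a subgroup complement works. *)
Lemma periodic_complement_subgroup_complement (Omega T : {set G}) :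
  [set t + g | t in T] = T -> tiling_pair Omega T ->
  exists2 S : {set G}, zmod_closed S & tiling_pair Omega S.
Proof.
move=> pT /tiling_pairC tTO; have [f_inj tfT] := quotient_tiling pT tTO.
have [|S [S0 SB] /tiling_pairC/tiling_pairP sSO] := tile_H (Omega := f @: Omega).
  by exists (f @: T); apply: tiling_pairC.
exists (f @^-1: S).
  split=> [|x y]; rewrite !inE ?raddf0 // => xS yS.
  by rewrite raddfB SB.
apply/tiling_pairC/tiling_pairP => x.
rewrite -[RHS](sSO (f x)) big_imset //=; apply: eq_bigr => w _.
by rewrite inE raddfB.
Qed.

End CyclicQuotient.

(** * Induction on the dimension *)

(** The rows of [row_ebase g] form a basis whose first vector is proportional to [g]; [N] reads off
    the other coordinates and [N'] embeds them back. *)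
Lemma row_quotient (F : fieldType) m (g : 'rV[F]_m.+1) : g != 0 ->
  exists (N : 'M[F]_(m.+1, m)) (N' : 'M[F]_(m, m.+1)),
    N' *m N = 1%:M /\
    forall x : 'rV[F]_m.+1, x *m N = 0 -> exists k, x = k *: g.
Proof.
move=> g0; pose E : 'M[F]_(1 + m) := row_ebase g.
have E_unit : E \in unitmx := row_ebase_unit g.
pose e : 'rV[F]_(1 + m) := row_mx 1%:M 0.
have [u u0 gE] : exists2 u, u != 0 & g = u *: (e *m E).
  have rg : \rank g = 1%N.
    by apply/eqP; rewrite eqn_leq rank_leq_row lt0n mxrank_eq0.
  exists (col_ebase g 0 0).
    have := col_ebase_unit g; rewrite unitmxE det_mx11 unitfE //.
  rewrite -{1}[g]mulmx_ebase rg [col_ebase g]mx11_scalar mul_scalar_mx -scalemxAl.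
  have -> : pid_mx 1 = e.
    by rewrite -[LHS](@hsubmxK _ 1 1 m); congr row_mx;
      apply/matrixP => i j; rewrite !mxE !ord1.
  by congr (_ *: _); rewrite mxE eqxx.
exists (invmx E *m col_mx 0 1%:M), (row_mx 0 1%:M *m E).
split.
  by rewrite mulmxA mulmxK // mul_row_col mulmx0 mulmx1 add0r.
move=> x; rewrite mulmxA; set y : 'rV[F]_(1 + m) := x *m invmx E => yN.
have y_r : rsubmx y = 0.
  by rewrite -yN -{2}[y]hsubmxK mul_row_col mulmx0 mulmx1 add0r.
(* Only the first coordinate of [x] survives, along [e *m E], which is [g] divided by [u]. *)
exists (lsubmx y 0 0 / u); rewrite gE scalerA mulfVK //.
rewrite scalemxAl /e scale_row_mx scaler0 scalemx1 -mx11_scalar -y_r hsubmxK.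
by rewrite mulmxKV.
Qed.

Lemma tile_subgroup_complement (p n : nat) :
  (forall m, (m <= n)%N -> PT_property 'rV['F_p]_m) ->
  forall Omega : {set 'rV['F_p]_n}, tile Omega ->
  exists2 T : {set 'rV['F_p]_n}, zmod_closed T & tiling_pair Omega T.
Proof.
elim: n => [|m IHm] PT Omega [T tOT].
  exists [set 0]; first by split=> [|x y]; rewrite ?inE // !thinmx0 ?eqxx.
  apply/tiling_pairP => x; rewrite big_set1 [x - 0]thinmx0.
  have [[w t] [/= [wO _ _] _]] := tOT 0.
  by rewrite thinmx0 in wO; rewrite wO.
have {}IHm := IHm (fun k km => PT k (leqW km)).
have quot (g : 'rV['F_p]_m.+1) : g != 0 ->
    [/\ ([set w + g | w in Omega] = Omega ->
         exists2 S : {set 'rV['F_p]_m.+1}, zmod_closed S & tiling_pair Omega S)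
      & forall T' : {set 'rV['F_p]_m.+1},
         [set t + g | t in T'] = T' -> tiling_pair Omega T' ->
         exists2 S : {set 'rV['F_p]_m.+1}, zmod_closed S & tiling_pair Omega S].
  move=> /row_quotient[N [N' [NK kerN]]].
  have sK : cancel (mulmxr N') (mulmxr N : 'rV['F_p]_m.+1 -> 'rV['F_p]_m).
    by move=> y /=; rewrite -mulmxA NK mulmx1.
  have ker_f (x : 'rV['F_p]_m.+1) : mulmxr N x = 0 -> exists k, x = g *+ k.
    (* Over the prime field a scalar multiple is a natural multiple, so the line spanned by [g] is
       cyclic. *)
    move=> /kerN[k ->]; exists (k : nat).
    by rewrite -scaler_nat natr_Zp.
  split=> [pO | T' pT tOT'].
    exact: (periodic_tile_subgroup_complement sK ker_f IHm pO tOT).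
  exact: (periodic_complement_subgroup_complement sK ker_f IHm pT tOT').
case: (PT m.+1 (leqnn _)) => [G1 | /(_ _ _ tOT)].
  have /fintype_le1P G_eq : (#|'rV['F_p]_m.+1| <= 1)%N by rewrite G1.
  have /matrixP/(_ 0 0) : const_mx 1 = 0 :> 'rV['F_p]_m.+1 by exact: G_eq.
  by rewrite !mxE => /eqP; rewrite oner_eq0.
case=> [[_ [g g0 pO]] | [T' [_ [g g0 pT]] tOT']].
  by have [+ _] := quot g g0; apply.
by have [_ +] := quot g g0; apply; [exact: pT | exact: tOT'].
Qed.

Lemma PT_descent_iter (R : finNzRingType) d n m : (3 <= #|'rV[R]_d|)%N ->
  PT_property 'rV[R]_(m + n * d) -> PT_property 'rV[R]_m.
Proof.
move=> d3; elim: n => [|n IHn]; first by rewrite mul0n addn0.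
by rewrite mulSnr addnA => /(PT_descent d3).
Qed.

Theorem theorem1p8 (p n : nat) (p_prime : prime p) (n_ge1 : (1 <= n)%N)
    (Omega : {set 'rV['F_p]_n}) (Omega_tile : tile Omega) :
  ((3 <= p)%N -> PT_property 'rV['F_p]_n ->
     exists2 T : {set 'rV['F_p]_n}, zmod_closed T & tiling_pair Omega T)
  /\
  (p = 2%N -> PT_property 'rV['F_p]_n -> PT_property 'rV['F_p]_n.-1 ->
     exists2 T : {set 'rV['F_p]_n}, zmod_closed T & tiling_pair Omega T).
Proof.
split=> [p3 PTn | p2 PTn PTn1]; apply: tile_subgroup_complement => // m mn.
  (* For [p >= 3], K of dimension one is large enough, so every dimension below [n] is reached. *)
  apply: (@PT_descent_iter _ 1 (n - m)).
    by rewrite card_mx card_Fp // mul1n expn1.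
  by rewrite muln1 subnKC.
have card2 : (3 <= #|'rV['F_p]_2|)%N by rewrite card_mx card_Fp // p2.
(* For [p = 2], K has order 4 and the dimension drops by two, so the descent starts at [n] or
   [n - 1] according to the parity of [n - m]. *)
apply: (@PT_descent_iter _ 2 (n - m)./2 m card2).
have [odd_nm | even_nm] := boolP (odd (n - m)).
  by have -> : (m + (n - m)./2 * 2)%N = n.-1 by lia.
by have -> : (m + (n - m)./2 * 2)%N = n by lia.
Qed.
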